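(* Let $k\geq 2$. For each nonzero dimension vector $\beta\in\mathbb Z_{\geq 0}^k$, the number $N_{\mathbb B}(\beta)$ of nilpotent semirepresentations of the cyclic quiver over the Boolean semiring $\mathbb B$ with dimension vector $\beta$ is $$N_{\mathbb B}(\beta)=\sum_{\gamma<\beta}(-1)^{\mathbf 1\cdot(\beta-\gamma)-1}\binom{\beta}{\gamma}2^{(\beta-\gamma)\cdot\sigma\gamma}N_{\mathbb B}(\gamma),$$ where the sum runs over all $\gamma\in\mathbb Z_{\geq 0}^k$ with $\gamma<\beta$.
   Context: Indices are taken modulo $k$. $\mathbb B=\{0,1\}$ is the Boolean semiring, where $1+1=1$. $Q$ is the cyclic quiver $1\to 2\to\cdots\to k\to 1$. For $\beta\in\mathbb Z_{\geq 0}^k$, fix free $\mathbb B$-semimodules $M_1,\ldots,M_k$ with $\mathrm{rank}\,M_i=\beta_i$ and set $\mathrm{Rep}_{\mathbb B}(Q,\beta)=\prod_{i=1}^k\mathrm{Hom}_{\mathbb B}(M_i,M_{i+1})$ (equivalently, $k$-tuples of matrices over $\mathbb B$, the $i$-th of size $\beta_{i+1}\times\beta_i$). A semirepresentation $f=(f_1,\ldots,f_k)$ is nilpotent if for each $1\leq i\leq k$ and all sufficiently large $\ell$ the composition $f_{i+\ell-1}\circ\cdots\circ f_i$ is zero. $N_{\mathbb B}(\beta)$ is the number of nilpotent elements of $\mathrm{Rep}_{\mathbb B}(Q,\beta)$. Notation: $\beta\cdot\gamma=\sum_{i=1}^k\beta_i\gamma_i$; $\sigma\gamma=(\gamma_2,\ldots,\gamma_k,\gamma_1)$;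 $\mathbf 1=(1,\ldots,1)$; $\gamma\leq\beta$ means $\gamma_i\leq\beta_i$ for all $i$, and $\gamma<\beta$ means $\gamma\leq\beta$ and $\gamma\neq\beta$; $\binom{\beta}{\gamma}=\prod_{i=1}^k\binom{\beta_i}{\gamma_i}$. *)

(* Defs.v *)
From HB Require Import structures.
From mathcomp Require Import all_boot all_order all_algebra.
From mathcomp Require Import boolp classical_sets functions cardinality fsbigop.

Set Implicit Arguments.
Unset Strict Implicit.
Unset Printing Implicit Defensive.

Import GRing.Theory.

Local Open Scope ring_scope.

(* The Boolean semiring.  [bool] itself already carries the ring structure of
   F_2 (addition is exclusive or), so a fresh type is used here. *)
Record boolsr := BoolSR { bval : bool }.

HB.instance Definition _ := [isNew for bval].
HB.instance Definition _ := [Finite of boolsr by <:].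

Module BoolSRTheory.

Definition add (x y : boolsr) := BoolSR (bval x || bval y).
Definition mul (x y : boolsr) := BoolSR (bval x && bval y).

Lemma addA : associative add. Proof. by do 3![case=> -[]]. Qed.
Lemma addC : commutative add. Proof. by do 2![case=> -[]]. Qed.
Lemma add0 : left_id (BoolSR false) add. Proof. by case. Qed.
Lemma mulA : associative mul. Proof. by do 3![case=> -[]]. Qed.
Lemma mulC : commutative mul. Proof. by do 2![case=> -[]]. Qed.
Lemma mul1 : left_id (BoolSR true) mul. Proof. by case. Qed.
Lemma mulD : left_distributive mul add. Proof. by do 3![case=> -[]]. Qed.
Lemma mul0 : left_zero (BoolSR false) mul. Proof. by []. Qed.

End BoolSRTheory.

HB.instance Definition _ := GRing.isNmodule.Build boolsr
  BoolSRTheory.addA BoolSRTheory.addC BoolSRTheory.add0.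
HB.instance Definition _ := GRing.Nmodule_isComNzSemiRing.Build boolsr
  BoolSRTheory.mulA BoolSRTheory.mulC BoolSRTheory.mul1
  BoolSRTheory.mulD BoolSRTheory.mul0 isT.

Section CyclicQuiver.

Variable k : nat.

(* Vertices are numbered from 0: ['I_k] stands for {1, ..., k}, and
   [ordS i] is the vertex i + 1 modulo k. *)
Definition dimvec : Type := {ffun 'I_k -> nat}.
HB.instance Definition _ := Choice.on dimvec.

Implicit Types beta gamma : dimvec.

Definition dim0 : dimvec := [ffun=> 0%N].
Definition dim1 : dimvec := [ffun=> 1%N].
Definition dim_sub beta gamma : dimvec := [ffun i => (beta i - gamma i)%N].
Definition dim_shift gamma : dimvec := [ffun i => gamma (ordS i)].
Definition dim_dot beta gamma : nat := (\sum_i beta i * gamma i)%N.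
Definition dim_binom beta gamma : nat := (\prod_i 'C(beta i, gamma i))%N.
Definition dim_le gamma beta : Prop := forall i, (gamma i <= beta i)%N.
Definition dim_lt gamma beta : Prop := dim_le gamma beta /\ gamma <> beta.

(* Matrices act on column vectors, so composition is the product [*m] in the
   usual order. *)
Definition rep beta : finType :=
  {dffun forall i : 'I_k, 'M[boolsr]_(beta (ordS i), beta i)}.

(* [rep_comp f i l] is f_(i+l-1) o ... o f_i : M_i -> M_(i+l). *)
Fixpoint rep_comp beta (f : rep beta) (i : 'I_k) (l : nat) :
    'M[boolsr]_(beta (iter l (@ordS k) i), beta i) :=
  if l is l'.+1 then f (iter l' (@ordS k) i) *m rep_comp f i l' else 1%:M.

Definition nilpotent beta (f : rep beta) : Prop :=
  forall i : 'I_k, exists L : nat, forall l : nat, (L <= l)%N ->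
    rep_comp f i l = 0.

Definition num_nilpotent beta : nat := #|[pred f : rep beta | `[< nilpotent f >]]|.

(* Hence a [\sum_(gamma \in _)] over this set, which by convention vanishes on
   infinite supports, is the genuine sum. *)
Lemma finite_dim_lt beta :
  finite_set [set gamma : dimvec | dim_lt gamma beta]%classic.
Proof.
pose val_of (g : {dffun forall i : 'I_k, 'I_(beta i).+1}) : dimvec :=
  [ffun i => g i : nat].
apply: (@sub_finite_set _ _ (val_of @` setT)%classic); last first.
  by apply: finite_image; exact: finite_finset.
move=> gamma [le_gb _].
exists [ffun i => inord (gamma i) : 'I_(beta i).+1] => //.
by apply/ffunP => i; rewrite !ffunE inordK // ltnS.
Qed.

End CyclicQuiver.

(* Main.v *)
Require Import Defs.
From HB Require Import structures.
From mathcomp Require Import all_boot all_order all_algebra.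
From mathcomp Require Import boolp classical_sets functions cardinality fsbigop.

Set Implicit Arguments.
Unset Strict Implicit.
Unset Printing Implicit Defensive.

Import GRing.Theory.

Local Open Scope ring_scope.

(** A representation of dimension vector beta is a set of arrows (i,a) -> (i+1,b)
    between the beta_1 + ... + beta_k basis vectors, and it is nilpotent exactly
    when these arrows form an acyclic digraph.  A nonempty acyclic digraph has a
    source, so the alternating sum of (-1)^|S| over the subsets S of its sources
    vanishes.  Summing over all digraphs and exchanging the sums, the digraphs
    for which S consists of sources are given by an arbitrary set of arrows from
    S to its complement together with an acyclic digraph on the complement. *)

(** * Alternating sums over subsets *)

Lemma sum_sign_subset (T : finType) (R : {set T}) :
  \sum_(S : {set T} | S \subset R) (-1) ^+ #|S| = (R == finset.set0)%:R :> int.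
Proof.
(* Expanding the product of the [F i + 1] gives one term per subset [S]: its sign if [S] lies in
   [R], and 0 otherwise. A point of [R] makes the product vanish. *)
pose F x : int := if x \in R then -1 else 0.
have distr := @bigA_distr int 0 1 *%R +%R T F (fun=> 1).
transitivity (\prod_i (F i + 1)); last first.
  case: eqP => [R0 | /eqP/set0Pn[x Rx]].
    by rewrite big1 // => i _; rewrite /F R0 inE add0r.
  by rewrite (bigD1 x) //= /F Rx addNr mul0r.
rewrite distr big_mkcond; apply: eq_bigr => S _.
rewrite -big_mkcond /=;
  case: ifPn => [/fintype.subsetP sSR | /subsetPn[x Sx Rx]].
  by rewrite -prodr_const; apply: eq_bigr => x /sSR Rx; rewrite /F Rx.
by rewrite (bigD1 x) //= /F (negPf Rx) mul0r.
Qed.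

(** * Acyclic digraphs on vertices coloured by the cyclic quiver *)

Section Quiver.

Variables (k : nat) (V : finType) (c : V -> 'I_k).
Implicit Types (E : {set V * V}) (S U : {set V}).

Definition arcs S U : {set V * V} :=
  [set p | [&& p.1 \in S, p.2 \in U & c p.2 == ordS (c p.1)]].

Definition edge E : rel V := [rel x y | (x, y) \in E].

(* On finitely many vertices, this says that the digraph [E] is acyclic. *)
Definition bounded E : Prop :=
  exists L, forall x p, path (edge E) x p -> (size p < L)%N.

Definition dags U : {set {set V * V}} :=
  [set E : {set V * V} | (E \subset arcs U U) && `[< bounded E >]].

Definition sources E : {set V} := [set x | [forall y, (y, x) \notin E]].

Lemma sub_bounded E E' : E \subset E' -> bounded E' -> bounded E.
Proof.
move=> /fintype.subsetP sEE' [L ltL]; exists L => x p Ep; apply: (ltL x).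
by apply: sub_path Ep => y z; apply: sEE'.
Qed.

(** Without sources every vertex has a predecessor, so walking backwards from [x] yields arbitrarily
    long paths. *)
Lemma sources_neq0 (x : V) E : bounded E -> sources E != finset.set0.
Proof.
move=> [L ltL]; apply/negP => /eqP src0.
have pred y : exists z, edge E z y.
  have : y \notin sources E by rewrite src0 inE.
  by rewrite inE negb_forall => /existsP[z]; rewrite negbK; exists z.
have [y [p [Ep szp]]] : exists y p, path (edge E) y p /\ size p = L.
  elim: L {ltL} => [|L [y [p [Ep szp]]]]; first by exists x, [::].
  by have [z Ezy] := pred y; exists z, (y :: p); rewrite /= Ezy Ep szp.
by have := ltL _ _ Ep; rewrite szp ltnn.
Qed.

(* Every vertex of a path other than the first one lies outside of the
   sources, so only the first step of a path can leave [S]. *)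
Lemma bounded_add_sources S E1 E2 :
    E1 \subset arcs S (~: S) -> E2 \subset arcs (~: S) (~: S) ->
  bounded E2 -> bounded (E1 :|: E2).
Proof.
move=> /fintype.subsetP sE1 /fintype.subsetP sE2 [L ltL].
exists L.+1 => x [|y p] //= /andP[Exy Ep]; rewrite ltnS; apply: (ltL y).
have {Exy} yS : y \notin S.
  by move: Exy; rewrite /edge /= inE => /orP[/sE1|/sE2]; rewrite !inE /=;
     case/and3P.
elim: p y yS Ep => //= z p IHp y yS /andP[Eyz Ep].
have E2yz : (y, z) \in E2.
  move: Eyz; rewrite /edge /= inE => /orP[/sE1|//].
  by rewrite inE /= (negPf yS).
by rewrite {1}/edge /= E2yz IHp //; have /sE2 := E2yz; rewrite !inE => /and3P[].
Qed.

(** No arrow enters a set of sources, so [E] is glued from its arrows leaving [S] and its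
    restriction to the complement. The two kinds of arrows differ in their tails, so gluing is
    injective. *)
Lemma card_dags_sources S :
  #|[set E in dags [set: V] | S \subset sources E]| =
  (2 ^ #|arcs S (~: S)| * #|dags (~: S)|)%N.
Proof.
pose glue (p : {set V * V} * {set V * V}) := p.1 :|: p.2.
rewrite -card_powerset -cardsX.
have glueK1 E1 E2 : E1 \subset arcs S (~: S) -> E2 \subset arcs (~: S) (~: S) ->
    (E1 :|: E2) :&: arcs S (~: S) = E1.
  move=> /fintype.subsetP sE1 /fintype.subsetP sE2; apply/setP => p.
  rewrite !inE; have := sE1 p; have := sE2 p; rewrite !inE.
  by case: (p \in E1) => [_ /(_ isT) ->|] //=; case: (p \in E2) => // /(_ isT);
     case: (p.1 \in S).
have glueK2 E1 E2 : E1 \subset arcs S (~: S) -> E2 \subset arcs (~: S) (~: S) ->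
    (E1 :|: E2) :&: arcs (~: S) (~: S) = E2.
  move=> /fintype.subsetP sE1 /fintype.subsetP sE2; apply/setP => p.
  rewrite !inE; have := sE1 p; have := sE2 p; rewrite !inE.
  case: (p \in E2) => [/(_ isT) -> _|] //=; first by rewrite orbT.
  by case: (p \in E1) => // _ /(_ isT); case: (p.1 \in S).
rewrite -(@card_in_imset _ _ glue); last first.
  move=> [E1 E2] [E1' E2']; rewrite !inE /= /glue /=.
  move=> /and3P[s1 s2 _] /and3P[s1' s2' _] eqE.
  by rewrite -(glueK1 _ _ s1 s2) -{2}(glueK2 _ _ s1 s2) eqE glueK1 // glueK2.
apply: eq_card => E; apply/idP/imsetP.
  rewrite !inE => /andP[/andP[sE /asboolP bE] srcE].
  have split_E : E = (E :&: arcs S (~: S)) :|: (E :&: arcs (~: S) (~: S)).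
    apply/setP => -[x y]; rewrite !inE; case: (boolP (_ \in E)) => //= Exy.
    have /fintype.subsetP/(_ _ Exy) := sE; rewrite !inE /= => /eqP ->.
    rewrite eqxx !andbT -andb_orl orbN /=; apply/esym/negP => Sy.
    have /fintype.subsetP/(_ _ Sy) := srcE.
    by rewrite inE => /forallP/(_ x); rewrite Exy.
  exists (E :&: arcs S (~: S), E :&: arcs (~: S) (~: S)) => //.
  rewrite !inE /= !subsetIr /=; apply/asboolP; apply: sub_bounded bE.
  exact: subsetIl.
case=> -[E1 E2]; rewrite !inE /= => /and3P[s1 s2 /asboolP b2] -> /=.
rewrite /glue /=; apply/andP; split; last first.
  apply/fintype.subsetP => x Sx; rewrite inE; apply/forallP => y.
  rewrite inE; apply/negP => /orP[/(fintype.subsetP s1)|/(fintype.subsetP s2)];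
    by rewrite !inE /= Sx andbF.
apply/andP; split; last exact/asboolP/(bounded_add_sources s1 s2).
apply/fintype.subsetP => p.
by rewrite inE => /orP[/(fintype.subsetP s1)|/(fintype.subsetP s2)];
   rewrite !inE /= => /and3P[].
Qed.

Lemma sum_dags (x : V) :
  \sum_(S : {set V})
    (-1) ^+ #|S| * (2 ^ #|arcs S (~: S)| * #|dags (~: S)|)%:Z = 0.
Proof.
under eq_bigr do rewrite -card_dags_sources -sum1dep_card
  -natz natr_sum big_distrr /=.
rewrite (exchange_big_dep (mem (dags [set: V]))) /=; last first.
  by move=> ? ? _ /andP[].
(* For fixed [E] the inner sum runs over all subsets of its nonempty set of sources. *)
apply: big1 => E dE.
under eq_bigl do rewrite dE /=.
under eq_bigr do rewrite mulr1.
rewrite sum_sign_subset; move: dE; rewrite inE => /andP[_ /asboolP].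
by move=> /(sources_neq0 x)/negPf ->.
Qed.

(** * Dimension vectors of vertex sets *)

Definition dimv U : dimvec k := [ffun i => #|[set x in U | c x == i]|].

Lemma card_arcs S U :
  #|arcs S U| = (\sum_i dimv S i * dimv U (ordS i))%N.
Proof.
rewrite -sum1_card (partition_big (fun p : V * V => c p.1) xpredT) //=.
apply: eq_bigr => i _; rewrite !ffunE -cardsX -sum1_card.
apply: eq_bigl => -[x y]; rewrite !inE /=.
by case: (c x =P i) => [->|_]; rewrite ?andbT ?andbF ?andbA.
Qed.

Lemma card_dimv (S : {set V}) : (\sum_i dimv S i)%N = #|S|.
Proof.
rewrite -[RHS]sum1_card (partition_big c xpredT) //=; apply: eq_bigr => i _.
by rewrite ffunE -sum1_card; apply: eq_bigl => x; rewrite inE.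
Qed.

Lemma dimvC U i : dimv (~: U) i = (dimv [set: V] i - dimv U i)%N.
Proof.
rewrite !ffunE -(cardsID U [set x in [set: V] | c x == i]).
rewrite [X in (X + _ - _)%N](_ : _ = #|[set x in U | c x == i]|).
  by rewrite addKn; apply: eq_card => x; rewrite !inE.
by apply: eq_card => x; rewrite !inE andbC.
Qed.

Lemma dimv_le U i : (dimv U i <= dimv [set: V] i)%N.
Proof.
by rewrite !ffunE; apply: subset_leq_card; apply/fintype.subsetP => x;
   rewrite !inE => /andP[].
Qed.

Lemma dimv_eqT U : dimv U = dimv [set: V] -> U = [set: V].
Proof.
by move=> eqd; apply/eqP; rewrite eqEcard finset.subsetT -!card_dimv eqd leqnn.
Qed.

(** A set is determined by its traces on the colour classes [B i], which can be chosen independently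
    among the subsets of size [gamma i]. *)
Lemma card_dimv_eq (gamma : dimvec k) :
  #|[set U | dimv U == gamma]| = dim_binom (dimv [set: V]) gamma.
Proof.
pose B i : {set V} := [set x in [set: V] | c x == i].
pose F i : pred {set V} :=
  mem [set A : {set V} | A \subset B i & #|A| == gamma i].
transitivity #|family F|; last first.
  rewrite card_family /dim_binom /image_mem foldrE big_map /= big_enum /=.
  by apply: eq_bigr => i _; rewrite ffunE -cards_draws.
pose cut U : {ffun 'I_k -> {set V}} := [ffun i => U :&: B i].
have cut_inj : injective cut.
  move=> U U' /ffunP eqc; apply/setP => x.
  by have := eqc (c x); rewrite !ffunE => /setP/(_ x); rewrite !inE eqxx !andbT.
rewrite -(card_imset _ cut_inj); apply: eq_card => f; apply/imsetP/familyP.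
  move=> [U]; rewrite inE => /eqP dU -> i; rewrite !ffunE inE subsetIr /=.
  by rewrite -dU ffunE; apply/eqP; apply: eq_card => x; rewrite !inE.
move=> Ff; pose U := [set x | x \in f (c x)].
have fE i x : (x \in U) && (c x == i) = (x \in f i).
  have := Ff i; rewrite inE => /andP[/fintype.subsetP fB _]; rewrite inE.
  by apply/andP/idP => [[fx /eqP <-] //|fx]; have := fB _ fx; rewrite !inE =>
    /eqP ->.
exists U; last first.
  by apply/ffunP => i; rewrite !ffunE; apply/setP => x; rewrite -fE !inE.
rewrite inE; apply/eqP/ffunP => i; rewrite ffunE.
have := Ff i; rewrite inE => /andP[_ /eqP <-].
by apply: eq_card => x; rewrite finset.in_set fE.
Qed.

End Quiver.

(** * Boolean matrices as adjacency matrices *)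

Lemma bval_sum (I : finType) (F : I -> boolsr) :
  bval (\sum_i F i) = [exists i, bval (F i)].
Proof. by rewrite (@big_morph _ _ bval false orb) // big_orE. Qed.

Lemma boolsr_eq0 (x : boolsr) : (x == 0) = ~~ bval x.
Proof. by case: x => -[]. Qed.

Section Adjacency.

Variables (k : nat) (V : finType) (c : V -> 'I_k) (U : {set V}).
Variables (gamma : dimvec k) (h : {i : 'I_k & 'I_(gamma i)} -> V).
Hypotheses (h_inj : injective h) (h_im : forall x, (x \in U) = (x \in codom h)).
Hypothesis c_h : forall u, c (h u) = tag u.
Implicit Types (E : {set V * V}) (f : rep gamma).

(** The map [h] numbers [U] colour by colour; [vtx a] stands for the basis vector [a] at the quiver
    vertex [i]. *)
Let vtx i (a : 'I_(gamma i)) : V := h (Tagged (fun i => 'I_(gamma i)) a).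

Lemma vtx_onto x : x \in U -> exists a : 'I_(gamma (c x)), x = vtx a.
Proof.
rewrite h_im => /codomP[[i a] ->].
by rewrite c_h /=; exists a.
Qed.

Lemma vtx_inj i : injective (@vtx i).
Proof. by move=> a b /h_inj/eqP; rewrite eq_Tagged => /eqP. Qed.

Definition rep_of E : rep gamma :=
  [ffun i => \matrix_(b, a) BoolSR ((vtx a, vtx b) \in E)].

Definition graph_of f : {set V * V} :=
  \bigcup_i [set p | [exists a, exists b,
     bval (f i b a) && (p == (vtx a, vtx b))]].

Lemma graph_of_sub f : graph_of f \subset arcs c U U.
Proof.
apply/fintype.subsetP => p /bigcupP[i _]; rewrite inE.
move=> /existsP[a /existsP[b /andP[_ /eqP ->]]].
by rewrite inE /= /vtx !h_im !codom_f !c_h /= eqxx.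
Qed.

Lemma graph_ofK f : rep_of (graph_of f) = f.
Proof.
apply/ffunP => i; rewrite ffunE; apply/matrixP => b a; rewrite mxE.
case fba: (f i b a) => [[]]; congr BoolSR.
  apply/bigcupP; exists i => //; rewrite inE.
  by apply/existsP; exists a; apply/existsP; exists b; rewrite fba /=.
apply/bigcupP => -[j _]; rewrite inE => /existsP[a' /existsP[b']].
case/andP=> + /eqP[/[dup] eqa /(congr1 c)]; rewrite !c_h /= => + eqij.
(* Comparing colours of tails identifies [j] with [i]; only then do [a'] and [b'] have the types
   that [vtx_inj] needs. *)
move: a' b' eqa; rewrite -eqij => a' b' /vtx_inj <- fba' /vtx_inj eqb.
by rewrite -eqb fba in fba'.
Qed.

Lemma rep_of_inj E E' : E \subset arcs c U U -> E' \subset arcs c U U ->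
  rep_of E = rep_of E' -> E = E'.
Proof.
move=> sE sE' eqf.
have aux x y : (x, y) \in arcs c U U -> ((x, y) \in E) = ((x, y) \in E').
  rewrite inE /= => /and3P[/vtx_onto[a xa] /vtx_onto[b yb] /eqP cy].
  move: b yb; rewrite cy => b yb.
  have := congr1 (fun g : rep gamma => g (c x) b a) eqf.
  by rewrite !ffunE !mxE -xa -yb => -[].
apply/setP => -[x y]; apply/idP/idP => Exy.
  by rewrite -aux //; apply: (fintype.subsetP sE).
by rewrite aux //; apply: (fintype.subsetP sE').
Qed.

(** A Boolean sum of products is a disjunction of conjunctions, so a nonzero entry unfolds step by
    step into a walk. *)
Lemma path_rep_comp E i l (a : 'I_(gamma i)) b :
  bval (rep_comp (rep_of E) i l b a) ->
  exists p, [/\ path (edge E) (vtx a) p, size p = l & last (vtx a) p = vtx b].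
Proof.
elim: l b => [|l IHl] b /=.
  rewrite mxE; case: eqP => [->|] //= _; by exists [::].
rewrite mxE bval_sum => /existsP[d /=]; rewrite ffunE mxE /= => /andP[Edb].
case/IHl => p [Ep szp lastp]; exists (rcons p (vtx b)).
by rewrite rcons_path size_rcons last_rcons szp lastp Ep.
Qed.

(** Since 1 + 1 = 1, walks never cancel. The index [b] belongs to the conclusion because its type
    depends on the length of [p]. *)
Lemma rep_comp_path E i (a : 'I_(gamma i)) p :
    E \subset arcs c U U -> path (edge E) (vtx a) p ->
  exists2 b, last (vtx a) p = vtx b & bval (rep_comp (rep_of E) i (size p) b a).
Proof.
move=> /fintype.subsetP sE.
elim/last_ind: p => [|p y IHp] /=; first by exists a; rewrite // mxE eqxx.
rewrite rcons_path last_rcons size_rcons => /andP[/IHp[d lastp compd]].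
rewrite lastp /edge /= => Edy.
have := sE _ Edy; rewrite inE /= c_h /= => /and3P[_ /vtx_onto[b yb] /eqP cy].
move: b yb; rewrite cy => b yb; exists b; first exact: yb.
rewrite mxE bval_sum; apply/existsP; exists d => /=.
by rewrite ffunE mxE /= -yb Edy.
Qed.

Lemma nilpotent_rep_of E : E \subset arcs c U U ->
  nilpotent (rep_of E) <-> bounded E.
Proof.
move=> sE; split=> [nilE | [L ltL] i]; last first.
  exists L => l leLl; apply/matrixP => b a; apply/eqP; rewrite mxE boolsr_eq0.
  apply/negP => /path_rep_comp[p [Ep szp _]].
  by have := ltL _ _ Ep; rewrite szp ltnNge leLl.
have [L compL] := choice nilE.
exists (\max_i L i).+1 => x [|y p] // Ep.
have /vtx_onto[a xa] : x \in U.
  move: Ep => /= /andP[/(fintype.subsetP sE)].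
  by rewrite inE => /and3P[].
rewrite ltnS leqNgt; apply/negP => ltLp.
move: (Ep); rewrite {1}xa => /(rep_comp_path sE)[b _].
rewrite compL ?mxE //; apply: leq_trans (ltnW ltLp).
exact: (leq_bigmax (c x)).
Qed.

Lemma card_dags_rep : #|dags c U| = num_nilpotent gamma.
Proof.
have inj : {in dags c U &, injective rep_of}.
  by move=> E E'; rewrite !inE => /andP[sE _] /andP[sE' _]; apply: rep_of_inj.
rewrite -(card_in_imset inj); apply: eq_card => f; apply/imsetP/idP.
  case=> E; rewrite inE => /andP[sE /asboolP bE] ->.
  exact/asboolP/nilpotent_rep_of.
move=> /asboolP nilf; exists (graph_of f); last by rewrite graph_ofK.
rewrite inE graph_of_sub; apply/asboolP/nilpotent_rep_of.
  exact: graph_of_sub.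
by rewrite graph_ofK.
Qed.

End Adjacency.

(** Enumerating each colour class of [U] separately supplies the numbering [h]. *)
Lemma card_dags (k : nat) (V : finType) (c : V -> 'I_k) (U : {set V}) :
  #|dags c U| = num_nilpotent (dimv c U).
Proof.
pose F i := [set x in U | c x == i].
have eqF i : dimv c U i = #|F i| by rewrite ffunE.
pose h (u : {i : 'I_k & 'I_(dimv c U i)}) : V :=
  enum_val (cast_ord (eqF (tag u)) (tagged u)).
have hF u : h u \in F (tag u) by apply: enum_valP.
have c_h u : c (h u) = tag u by have := hF u; rewrite inE => /andP[_ /eqP].
apply: (@card_dags_rep _ _ _ _ _ h) => //.
  move=> [i a] [j b] eqh; have := congr1 c eqh; rewrite !c_h /= => eqij.
  move: b eqh; rewrite -eqij => b /enum_val_inj/cast_ord_inj /= ->.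
  by [].
move=> x; apply/idP/codomP => [Ux | [u ->]]; last first.
  by have := hF u; rewrite inE => /andP[].
have Fx : x \in F (c x) by rewrite inE Ux eqxx.
exists (Tagged (fun i => 'I_(dimv c U i))
  (cast_ord (esym (eqF (c x))) (enum_rank_in Fx x))).
by rewrite /h /= cast_ordKV enum_rankK_in.
Qed.

(** The disjoint union of the bases realises an arbitrary [beta] as the dimension vector of a vertex
    set. *)
Lemma dimv_tag (k : nat) (beta : dimvec k) :
  dimv (fun x : {i : 'I_k & 'I_(beta i)} => tag x) (finset.setTfor _) = beta.
Proof.
apply/ffunP => i; rewrite ffunE -[RHS]card_ord.
pose t (a : 'I_(beta i)) := Tagged (fun i => 'I_(beta i)) a.
have t_inj : injective t by move=> a b /eqP; rewrite eq_Tagged => /eqP.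
rewrite -(card_imset _ t_inj); apply: eq_card => x; rewrite !inE /=.
apply/eqP/imsetP => [| [a _ ->] //].
by case: x => j a /= eqij; move: a; rewrite eqij => a; exists a.
Qed.

(** * The recursion for nilpotent representations *)

Theorem theorem4p2 (k : nat) (hk : (2 <= k)%N) (beta : dimvec k)
    (hbeta : beta <> dim0 k) :
  (num_nilpotent beta)%:Z =
  \sum_(gamma \in [set gamma : dimvec k | dim_lt gamma beta]%classic)
    (-1) ^+ (dim_dot (dim1 k) (dim_sub beta gamma) - 1)%N
    * (dim_binom beta gamma)%:Z
    * 2 ^+ dim_dot (dim_sub beta gamma) (dim_shift gamma)
    * (num_nilpotent gamma)%:Z.
Proof.
pose V : finType := {i : 'I_k & 'I_(beta i)}.
pose c (x : V) : 'I_k := tag x.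
have dimT : dimv c [set: V] = beta by exact: dimv_tag.
have [x _] : exists x : V, true.
  have [i bi] : exists i, beta i != 0%N.
    apply/existsP; rewrite -negb_forall; apply/negP => /forallP b0.
    by apply: hbeta; apply/ffunP => i; rewrite ffunE; apply/eqP/b0.
  rewrite -lt0n in bi.
  by exists (Tagged (fun i => 'I_(beta i)) (Ordinal bi)).
(* The contribution of a single set [U] of dimension vector [gamma], hence without binomial
   coefficient. *)
pose T gamma : int :=
  (-1) ^+ dim_dot (dim1 k) (dim_sub beta gamma)
    * 2 ^+ dim_dot (dim_sub beta gamma) (dim_shift gamma)
    * (num_nilpotent gamma)%:Z.
have codim U : dim_dot (dim1 k) (dim_sub beta (dimv c U)) = #|~: U|.
  rewrite -(card_dimv c); apply: eq_bigr => i _.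
  by rewrite dimvC dimT !ffunE mul1n.
(* This is [sum_dags] reindexed by complements. *)
have sumT : \sum_(U : {set V}) T (dimv c U) = 0.
  rewrite -[RHS](sum_dags c x) (reindex_inj (@finset.setC_inj _)).
  apply: eq_bigr => S _.
  rewrite /T codim finset.setCK card_dags PoszM mulrA -[Posz (2 ^ _)]natz natrX.
  congr (_ * _ ^+ _ * _); rewrite card_arcs; apply: eq_bigr => i _.
  have -> : dimv c S i = (beta i - dimv c (~: S) i)%N.
    by rewrite -{1}(finset.setCK S) dimvC dimT.
  by rewrite !ffunE.
pose r := undup [seq dimv c U | U <- enum [pred U : {set V} | U != [set: V]]].
have mem_r U : (dimv c U \in r) = (U != [set: V]).
  rewrite mem_undup; apply/mapP/idP => [[U' + eqd] | neT]; last first.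
    by exists U; rewrite // mem_enum inE.
  rewrite mem_enum inE; apply: contraNneq => UT.
  by apply/eqP/(@dimv_eqT _ _ c); rewrite -eqd UT.
have binomE gamma :
    (dim_binom beta gamma)%:Z = \sum_(U | dimv c U == gamma) 1.
  by rewrite -dimT -(card_dimv_eq c) -sum1dep_card -natz natr_sum.
have r_lt gamma : gamma \in r -> dim_lt gamma beta.
  rewrite mem_undup => /mapP[U]; rewrite mem_enum inE => neT ->.
  split=> [i|]; first by rewrite -dimT dimv_le.
  by rewrite -dimT => /dimv_eqT UT; rewrite UT eqxx in neT.
rewrite (fsbigE r) ?undup_uniq //; first last.
(* Outside [r] the binomial coefficient vanishes: a set counted by it would be all of [V], forcing
   [gamma] to equal [beta]. *)
- move=> gamma [_ neq_gb] gr; rewrite binomE big_pred0 ?mulr0 ?mul0r // => U.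
  apply/eqP => dU; apply: neq_gb; rewrite -dU in gr *.
  by move: gr; rewrite mem_r negbK => /eqP ->.
transitivity (- \sum_(gamma <- r) (dim_binom beta gamma)%:Z * T gamma).
  (* The sets are grouped by dimension vector, the binomial coefficient counting each group. *)
  have -> : \sum_(gamma <- r) (dim_binom beta gamma)%:Z * T gamma
      = \sum_(U | U != [set: V]) T (dimv c U).
    under eq_bigr do rewrite binomE big_distrl /=.
    rewrite (exchange_big_dep xpredT) //= [RHS]big_mkcond.
    apply: eq_bigr => U _; rewrite -mem_r; case: ifPn => rU; last first.
      rewrite big_seq_cond big_pred0 // => gamma.
      by apply: contraNF rU => /andP[gr /eqP ->].
    rewrite (eq_bigl (pred1 (dimv c U))) => [|gamma]; last by rewrite eq_sym.
    by rewrite -big_filter filter_pred1_uniq ?undup_uniq // big_seq1 mul1r.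
  (* The whole set contributes [num_nilpotent beta], since both exponents in [T beta] vanish. *)
  have := sumT; rewrite (bigD1 [set: V]) //= => /eqP.
  rewrite addr_eq0 => /eqP <-.
  have sub0 i : dim_sub beta beta i = 0%N by rewrite ffunE subnn.
  by rewrite dimT /T /dim_dot !big1 ?mul1r // => i _; rewrite sub0 ?muln0.
rewrite -sumrN big_seq [RHS]big_seq_cond; apply: eq_big => [gamma | gamma gr].
  by apply/idP/andP => [gr | []] //; split=> //; rewrite inE; apply: r_lt.
move: gr; rewrite mem_undup => /mapP[U]; rewrite mem_enum inE => neT ->.
(* As [U] is proper, its complement is nonempty: the truncated [- 1] in the exponent is a true
   subtraction and accounts for the sign. *)
rewrite /T codim; case: #|_| (cards_eq0 (~: U)) => [/esym/eqP|n _].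
  move/(congr1 (@finset.setC _)); rewrite finset.setCK finset.setC0 => UT.
  by rewrite UT eqxx in neT.
by rewrite subn1 exprS mulN1r /= !mulNr mulrN opprK !mulrA [_%:Z * _]mulrC.
Qed.
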